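(* Let $a=(a_k)_{k\in\mathbb{N}}\in\ell^\infty$ with $\|a\|_\infty=1$. Then the following are equivalent: (1) $r(T_a)<1$; (2) $M(|a|)<1$; (3) $\|a\|_w<1$; (4) there exist $C>0$ and $\lambda\in(0,1)$ such that $$\prod_{k=1}^{n}|a_{k+j-1}|\le C\lambda^n\qquad\text{for all } n\in\mathbb{N},\ j\in\mathbb{N}.$$
   Context: $\mathbb{N}=\{1,2,3,\dots\}$. $\ell^2$ is the complex Hilbert space of square-summable unilateral sequences, and $\ell^\infty$ the complex Banach space of bounded complex sequences with the uniform norm $\|\cdot\|_\infty$. For $a\in\ell^\infty$, the (unilateral) weighted forward shift $T_a:\ell^2\to\ell^2$ is the bounded operator $T_a(x_1,x_2,\dots)=(0,a_1x_1,a_2x_2,\dots)$, and $r(T_a)$ is its spectral radius. The numerical radius of a bounded operator $T$ on a complex Hilbert space $H$ is $w(T)=\sup\{|\langle Tx,x\rangle| : x\in H,\ \|x\|=1\}$. Set $\|a\|_w:=w(T_a)$. Further, $|a|=(|a_k|)_{k\in\mathbb N}$ and $$M(|a|):=\lim_{n\to\infty}\sup_{j\in\mathbb{N}}\frac1n\sum_{k=1}^{n}|a_{k+j-1}|$$ (the limit exists for every bounded sequence). *)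

(* Defs.v *)
From HB Require Import structures.
From mathcomp Require Import all_boot all_order all_algebra.
From mathcomp Require Import complex ring lra.
From mathcomp Require Import all_classical all_reals all_analysis.

Set Implicit Arguments.
Unset Strict Implicit.
Unset Printing Implicit Defensive.

Import Order.TTheory GRing.Theory Num.Theory.
Import numFieldNormedType.Exports.
Export Normc.

Local Open Scope classical_set_scope.
Local Open Scope ring_scope.

(* In [R[i]] the norm [`|z|] is itself a complex number; [normc z : R] is the
   same modulus as a real number. *)

Section Operators.
Variables (R : realType) (U : lmodType R[i]) (dot : {dot U for Num.conj}).

Definition hnorm (x : U) : R := Num.sqrt (complex.Re (dot x x)).

Definition bounded_operator (T : U -> U) : Prop :=
  exists M : R, forall x, hnorm (T x) <= M * hnorm x.

Definition spectrum (T : {linear U -> U}) : set R[i] :=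
  [set l | ~ exists S : {linear U -> U}, [/\ bounded_operator S,
      forall x, S (T x - l *: x) = x & forall x, T (S x) - l *: S x = x]].

Definition spectral_radius (T : {linear U -> U}) : R :=
  sup [set normc l | l in spectrum T].

Definition numerical_radius (T : {linear U -> U}) : R :=
  sup [set normc (dot (T x) x) | x in [set x | hnorm x = 1]].

End Operators.

Section Ell2.
Variable R : realType.
Implicit Types u v : nat -> R[i].

Definition square_summable u : Prop :=
  cvgn (series (fun k => normc (u k) ^+ 2)).

Lemma sqr_normcE (z : R[i]) :
  normc z ^+ 2 = complex.Re z ^+ 2 + complex.Im z ^+ 2.
Proof. by case: z => x y /=; rewrite sqr_sqrtr// addr_ge0 ?sqr_ge0. Qed.

Lemma normc_ge0 (z : R[i]) : 0 <= normc z.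
Proof. by case: z => x y; exact: sqrtr_ge0. Qed.

Lemma is_cvg_seriesMl (c : R) (f : nat -> R) :
  cvgn (series f) -> cvgn (series (fun k => c * f k)).
Proof.
move=> cf; rewrite (_ : series _ = (fun n => c * series f n)).
  exact: is_cvgMl_tmp.
by apply/funext => n; rewrite /series /= mulr_sumr.
Qed.

Lemma lim_seriesMl (c : R) (f : nat -> R) :
  cvgn (series f) -> limn (series (fun k => c * f k)) = c * limn (series f).
Proof.
move=> cf; rewrite (_ : series _ = (fun n => c * series f n)).
  by rewrite (limM (is_cvg_cst _) cf) lim_cst.
by apply/funext => n; rewrite /series /= mulr_sumr.
Qed.

Lemma square_summable_le u v (c : R) :
  (forall k, normc (u k) ^+ 2 <= c * normc (v k) ^+ 2) ->
  square_summable v -> square_summable u.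
Proof.
move=> uv sv.
apply: (@series_le_cvg _ _ (fun k => c * normc (v k) ^+ 2)) => //.
- by move=> k; exact: sqr_ge0.
- by move=> k; apply: le_trans (uv k); exact: sqr_ge0.
- exact: is_cvg_seriesMl.
Qed.

Lemma square_summable0 : square_summable 0.
Proof.
rewrite /square_summable (_ : series _ = fun=> 0); first exact: is_cvg_cst.
apply/funext => n; rewrite /series /= big1// => k _.
by rewrite /= expr0n /= addr0 sqrtr0 expr0n.
Qed.

Lemma square_summableD u v :
  square_summable u -> square_summable v -> square_summable (u + v).
Proof.
move=> su sv.
apply: (@series_le_cvg _ _
  (fun k => 2 * (normc (u k) ^+ 2 + normc (v k) ^+ 2))) => [k|k|k|].
- exact: sqr_ge0.
- by rewrite mulr_ge0// addr_ge0 ?sqr_ge0.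
- rewrite !sqr_normcE addrfctE; case: (u k) (v k) => [x1 y1] [x2 y2] /=.
  rewrite -subr_ge0 [leRHS](_ : _ = (x1 - x2) ^+ 2 + (y1 - y2) ^+ 2).
    by rewrite addr_ge0 ?sqr_ge0.
  by ring.
- exact/is_cvg_seriesMl/is_cvg_seriesD.
Qed.

Lemma square_summableZ (c : R[i]) u :
  square_summable u -> square_summable (c *: u).
Proof.
apply: (@square_summable_le _ _ (normc c ^+ 2)) => k.
by rewrite scalrfctE [c *: _]/(c * _) normcM exprMn.
Qed.

Definition ell2_pred : {pred nat -> R[i]} :=
  [pred u | `[< square_summable u >]].

Lemma ell2_submod_closed : submod_closed ell2_pred.
Proof.
split; first by apply/asboolP; exact: square_summable0.
move=> c u v /asboolP su /asboolP sv; apply/asboolP.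
exact/square_summableD/sv/square_summableZ.
Qed.

HB.instance Definition _ :=
  GRing.isSubmodClosed.Build _ _ ell2_pred ell2_submod_closed.

End Ell2.

Record ell2 (R : realType) := Ell2 {
  ell2_val :> nat -> R[i];
  ell2_valP : ell2_val \in @ell2_pred R }.

HB.instance Definition _ (R : realType) := [isSub for @ell2_val R].
HB.instance Definition _ (R : realType) := [Choice of ell2 R by <:].
HB.instance Definition _ (R : realType) :=
  [SubChoice_isSubLmodule of ell2 R by <:].

Section InnerProduct.
Variable R : realType.
Implicit Types (u v : nat -> R[i]) (x y z : ell2 R).

Definition csummable u : Prop :=
  cvgn (series (fun k => complex.Re (u k))) /\
  cvgn (series (fun k => complex.Im (u k))).

(* The sum of a complex series, taken componentwise since [R[i]] carries no
   topology in the library. *)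
Definition csum u : R[i] :=
  Complex (limn (series (fun k => complex.Re (u k))))
          (limn (series (fun k => complex.Im (u k)))).

Lemma csumD u v : csummable u -> csummable v ->
  csum (fun k => u k + v k) = csum u + csum v.
Proof.
move=> [ru iu] [rv iv]; rewrite /csum /GRing.add /=; congr Complex.
- rewrite -(lim_seriesD ru rv); congr (limn (series _)); apply/funext => k.
  by rewrite [in RHS]addrfctE; case: (u k) (v k) => ? ? [].
- rewrite -(lim_seriesD iu iv); congr (limn (series _)); apply/funext => k.
  by rewrite [in RHS]addrfctE; case: (u k) (v k) => ? ? [].
Qed.

Lemma csummableZ (c : R[i]) u :
  csummable u -> csummable (fun k => c * u k).
Proof.
case: c => p q [ru iu]; split.
- rewrite (_ : (fun k => _) = (fun k => p * complex.Re (u k)) +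
    (fun k => (- q) * complex.Im (u k))).
    by apply: is_cvg_seriesD; exact: is_cvg_seriesMl.
  by apply/funext => k; rewrite [in RHS]addrfctE; case: (u k) => s t /=; ring.
- rewrite (_ : (fun k => _) = (fun k => p * complex.Im (u k)) +
    (fun k => q * complex.Re (u k))).
    by apply: is_cvg_seriesD; exact: is_cvg_seriesMl.
  by apply/funext => k; rewrite [in RHS]addrfctE; case: (u k) => s t /=; ring.
Qed.

Lemma csumZ (c : R[i]) u : csummable u ->
  csum (fun k => c * u k) = c * csum u.
Proof.
case: c => p q [ru iu]; rewrite /csum [in RHS]/GRing.mul /=; congr Complex.
- rewrite -!lim_seriesMl// -lim_seriesB; do ?exact: is_cvg_seriesMl.
  congr (limn (series _)); apply/funext => k.
  rewrite [RHS](_ : _ = p * complex.Re (u k) - q * complex.Im (u k))//.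
  by case: (u k).
- rewrite -!lim_seriesMl// -lim_seriesD; do ?exact: is_cvg_seriesMl.
  congr (limn (series _)); apply/funext => k.
  by rewrite [in RHS]addrfctE; case: (u k).
Qed.

Lemma csum_conj u : csummable u ->
  csum (fun k => (u k)^*) = (csum u)^*.
Proof.
move=> [ru iu]; rewrite /csum /Num.conj /=; congr Complex.
- by congr (limn (series _)); apply/funext => k; case: (u k).
- rewrite -(lim_seriesN iu); congr (limn (series _)).
  by apply/funext => k; rewrite [in RHS]opprfctE; case: (u k).
Qed.

Lemma csummable_dot u v : square_summable u -> square_summable v ->
  csummable (fun k => u k * (v k)^*).
Proof.
move=> su sv.
have dom (f : nat -> R) :
    (forall k, `|f k| <= normc (u k) ^+ 2 + normc (v k) ^+ 2) ->
    cvgn (series f).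
  move=> fuv; apply: (@normed_cvg R R^o).
  apply: (@series_le_cvg _ _
    (fun k => normc (u k) ^+ 2 + normc (v k) ^+ 2)) => [k|k|//|].
  - exact: normr_ge0.
  - by rewrite addr_ge0 ?sqr_ge0.
  - exact: is_cvg_seriesD.
by split; apply: dom => k; rewrite !sqr_normcE /Num.conj;
  case: (u k) (v k) => p q [s t] /=; rewrite ler_norml; apply/andP; split;
  have := (sqr_ge0 (p - s), sqr_ge0 (p + s), sqr_ge0 (q - t), sqr_ge0 (q + t),
    (sqr_ge0 (p - t), sqr_ge0 (p + t), sqr_ge0 (q - s), sqr_ge0 (q + s)),
    (sqr_ge0 p, sqr_ge0 q, sqr_ge0 s, sqr_ge0 t));
  move=> [[[[[h1 h2] h3] h4] [[[h5 h6] h7] h8]] [[[h9 h10] h11] h12]]; nra.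
Qed.

Definition ell2_dot x y : R[i] := csum (fun k => x k * (y k)^*).

Lemma ell2P x : square_summable x.
Proof. exact/asboolP/(ell2_valP x). Qed.
Arguments ell2P : clear implicits.

Lemma ell2_dotC x y : ell2_dot x y = (-1) ^+ false * (ell2_dot y x)^*.
Proof.
rewrite expr0 mul1r /ell2_dot -csum_conj; last first.
  by apply: csummable_dot; exact: ell2P.
by congr csum; apply/funext => k; rewrite rmorphM /= conjCK mulrC.
Qed.

Lemma ell2_dot_linearl z : linear_for *%R (ell2_dot ^~ z).
Proof.
move=> c x y.
have xz := csummable_dot (ell2P x) (ell2P z).
have yz := csummable_dot (ell2P y) (ell2P z).
rewrite /ell2_dot -(csumZ c xz) -(csumD (csummableZ c xz) yz).
by congr csum; apply/funext => k /=; rewrite mulrA -mulrDl.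
Qed.

Lemma ell2_dot_bilinear :
  bilinear_for *%R (Num.conj \; *%R) ell2_dot.
Proof.
split=> [z|z c x y]; first exact: ell2_dot_linearl.
rewrite ell2_dotC ell2_dot_linearl [ell2_dot z x]ell2_dotC.
by rewrite [ell2_dot z y]ell2_dotC !expr0 !mul1r rmorphD rmorphM /=.
Qed.

Lemma ell2_dot_gt0 x : x != 0 -> 0 < ell2_dot x x.
Proof.
move=> x0; have [k xk0] : exists k, x k != 0.
  apply: contrapT => /forallNP xN0; move/eqP: x0; apply; apply/val_inj.
  by apply/funext => k; have /negP := xN0 k; rewrite negbK => /eqP.
rewrite /ell2_dot /csum.
rewrite (_ : (fun k => complex.Re _) = (fun k => normc (x k) ^+ 2)); last first.
  apply/funext => j; rewrite sqr_normcE /Num.conj.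
  by case: (x j) => p q /=; ring.
rewrite (_ : (fun k => complex.Im _) = (fun=> 0)); last first.
  by apply/funext => j; rewrite /Num.conj; case: (x j) => p q /=; ring.
rewrite (_ : series (fun=> 0) = (fun=> 0)); last first.
  by apply/funext => n; rewrite /series /= big1.
rewrite lim_cst// ltcE /= eqxx /=.
apply: (@lt_le_trans _ _ (series (fun k => normc (x k) ^+ 2) k.+1)).
  rewrite seriesSr ltr_wpDl ?sumr_ge0// ?exprn_even_gt0//=.
    by move=> i _; exact: sqr_ge0.
  by apply: contraNN xk0 => /eqP/eq0_normc/eqP.
apply: nondecreasing_cvgn_le; last exact: ell2P.
by apply: nondecreasing_series => i _ _; exact: sqr_ge0.
Qed.

HB.instance Definition _ := bilinear_isBilinear.Build _ _ _ _ _ _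
  ell2_dot ell2_dot_bilinear.
HB.instance Definition _ := isHermitianSesquilinear.Build _ _ _ _
  ell2_dot ell2_dotC.
HB.instance Definition _ := isDotProduct.Build _ _ ell2_dot ell2_dot_gt0.

End InnerProduct.

Section WeightedShift.
Variable R : realType.

Record linfty := LInfty {
  linfty_val :> nat -> R[i];
  linfty_bounded : exists M : R, forall k, normc (linfty_val k) <= M }.

Definition linfty_norm (a : linfty) : R := sup (range (fun k => normc (a k))).

Implicit Types (a : linfty) (x : ell2 R).

Definition shift_seq a (u : nat -> R[i]) : nat -> R[i] :=
  fun k => if k is k'.+1 then a k' * u k' else 0.

Lemma series_shift_seq a x :
  series (fun k => normc (shift_seq a x k) ^+ 2) @ \oo -->
  limn (series (fun k => normc (a k * x k) ^+ 2)).
Proof.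
rewrite -cvg_shiftS [X in X @ _ --> _](_ : _ =
  series (fun k => normc (a k * x k) ^+ 2)); last first.
  apply/funext => n; rewrite /series /= big_nat_recl// [shift_seq a x 0]/=.
  by rewrite normc0 expr0n add0r.
have [M aM] := linfty_bounded a.
suff: square_summable (fun k => a k * x k) by [].
apply: (@square_summable_le _ _ x (M ^+ 2)) => [k|]; last exact: ell2P.
by rewrite normcM exprMn ler_wpM2r ?sqr_ge0// lerXn2r ?nnegrE ?normc_ge0//
  ?(le_trans (normc_ge0 (a k))).
Qed.

Lemma shift_seq_ell2 a x : shift_seq a x \in @ell2_pred R.
Proof.
by apply/asboolP; have := @series_shift_seq a x; exact: cvgP.
Qed.

Definition wshift a x : ell2 R := Ell2 (shift_seq_ell2 a x).

Lemma wshift_linear a : linear (wshift a).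
Proof.
move=> c x y; apply/val_inj/funext => -[|k].
- by rewrite -[LHS]/(0 : R[i]) -[RHS]/((c : R[i]) * 0 + 0) mulr0 addr0.
- rewrite -[LHS]/(a k * ((c : R[i]) * x k + y k)).
  by rewrite -[RHS]/((c : R[i]) * (a k * x k) + a k * y k) mulrDr mulrCA.
Qed.

HB.instance Definition _ a := GRing.isLinear.Build _ _ _ _ (wshift a)
  (wshift_linear a).

Lemma hnorm_ell2E x : hnorm (@ell2_dot R) x =
  Num.sqrt (limn (series (fun k => normc (x k) ^+ 2))).
Proof.
rewrite /hnorm /ell2_dot /csum /=; congr (Num.sqrt (limn (series _))).
by apply/funext => k; rewrite sqr_normcE; case: (x k) => p q /=; ring.
Qed.

Lemma wshift_bounded a : bounded_operator (@ell2_dot R) (wshift a).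
Proof.
have [M aM] := linfty_bounded a; exists M => x.
have M0 : 0 <= M := le_trans (normc_ge0 _) (aM 0).
rewrite !hnorm_ell2E /= (cvg_lim _ (@series_shift_seq a x))//.
rewrite -(ger0_norm M0) -sqrtr_sqr -sqrtrM ?sqr_ge0// ler_wsqrtr// -lim_seriesMl; last exact: ell2P.
have le k : normc (a k * x k) ^+ 2 <= M ^+ 2 * normc (x k) ^+ 2.
  by rewrite normcM exprMn ler_wpM2r ?sqr_ge0// lerXn2r ?nnegrE ?normc_ge0.
apply: lim_series_le => //; last by apply: is_cvg_seriesMl; exact: ell2P.
by apply: (@square_summable_le _ (fun k => a k * x k) x _ le); exact: ell2P.
Qed.

Definition wnorm a : R := numerical_radius (@ell2_dot R) (wshift a).

(* Sequences are indexed from 0, so [u k] is the term u_(k+1) of the usual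
   1-based notation and [u (k + j)] ranges over the window that starts at the
   [j]-th entry. The junk value at [n = 0] does not affect the limit. *)
Definition uniform_mean (u : nat -> R) : R :=
  limn (fun n : nat => sup (range (fun j : nat =>
    n%:R^-1 * \sum_(0 <= k < n) u (k + j)%N))).

End WeightedShift.

(* Main.v *)
Require Import Defs.
From HB Require Import structures.
From mathcomp Require Import all_boot all_order all_algebra.
From mathcomp Require Import complex ring lra.
From mathcomp Require Import all_classical all_reals all_analysis.

(** All four conditions are equivalent to a fifth, [mean_gap], about the moduli
    [u k = normc (a k)], which lie in [[0, 1]]: for one length [N > 0] and one
    [mu < 1], every window of [N] consecutive terms of [u] has mean at most
    [mu].

    What makes this single-scale condition usable is a coboundary identity.
    Averaging the sums of [u] over the windows of length [< N] that start at
    [k] gives a function [g] with values in [[0, N]] such that [u k] is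
    [g k - g k.+1] plus the mean of [u] over the [N]-window at [k]
    ([transfer_coboundary]).  Under a mean gap, [u k <= mu + g k - g k.+1]
    ([transfer_drop]), and three of the implications follow.
    - Telescoping gives [n mu + N] as a bound for every sum over [n]
      consecutive terms, that is, [mu + N / n] for their mean.  With the
      supremum of the means over [N]-windows as [mu], the same bound shows
      that the limit defining [M(u)] exists and is an infimum, so that
      [M(u) < 1] gives back a mean gap ([uniform_mean_lt1P]).
    - As [x <= exp (x - 1)], it also gives [exp N * exp (mu - 1) ^ n] as a
      bound for products of [n] consecutive terms ([mean_gap_prod]).
      Conversely, if the products of some length [n] are at most [1 / 2],
      then [1 - prod u <= sum (1 - u)] bounds the window sums by [n - 1 / 2]
      ([prod_mean_gap]).
    - The quadratic form [sum u_k x_k x_(k+1)] is bounded by a weighted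
      arithmetic-geometric inequality in each term, the weights being
      perturbations of [1] that are affine in [g] ([mean_gap_form]).  This
      bounds the numerical radius below [1].  Conversely, unit vectors that
      are constant in modulus on a window, with phases chosen so that all
      terms of [<Tx, x>] are nonnegative, show that
      [sum_(window of length n) u <= (n + 1) w(T)] ([window_le_wnorm]).

    The spectral radius is compared with the geometric decay of products.  The
    equation [(T - l) x = y] is a first-order recursion, solved by a kernel
    made of products of consecutive weights divided by powers of [l].  If the
    products are at most [C L ^ n] and [|l| > L], the kernel is dominated by
    a geometric convolution, which is bounded on [ell2], so [l] is not in the
    spectrum ([not_spectrum_wshift]).  Conversely, at a single [l] outside the
    spectrum, applying the bounded resolvent to the basis vectors displays the
    products as coordinates and bounds them by [C |l| ^ n]
    ([resolvent_prod]). *)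

Import Order.TTheory GRing.Theory Num.Theory.
Import numFieldNormedType.Exports.

Local Open Scope classical_set_scope.
Local Open Scope ring_scope.

(** * Window sums and the coboundary identity *)

Section WindowSums.
Context {R : realType}.
Implicit Types (u : nat -> R) (n m j k N : nat) (mu : R).

Definition window_sum u n j : R := \sum_(0 <= k < n) u (k + j)%N.

(** The condition through which all the equivalences pass: one window length
    suffices. *)
Definition mean_gap u : Prop :=
  exists N mu, [/\ (0 < N)%N, mu < 1 & forall j, window_sum u N j <= mu * N%:R].

Lemma window_sum0 u j : window_sum u 0 j = 0.
Proof. by rewrite /window_sum big_nil. Qed.

Lemma window_sumS u n j : window_sum u n.+1 j = window_sum u n j + u (n + j)%N.
Proof. by rewrite /window_sum big_nat_recr. Qed.

Lemma window_sum_recl u n j :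
  window_sum u n.+1 j = u j + window_sum u n j.+1.
Proof.
rewrite /window_sum big_nat_recl//; congr (_ + _).
by apply: eq_bigr => k _; rewrite addSnnS.
Qed.

(** The transfer function of the coboundary that separates [u] from its moving
    average over windows of length [N]. *)
Definition transfer u N k : R := N%:R^-1 * \sum_(0 <= m < N) window_sum u m k.

(** Prefixing [u k] to the window of length [m] at [k.+1] gives the window of
    length [m.+1] at [k]; averaging over [m < N], everything but the [N]-window
    cancels. *)
Lemma transfer_coboundary u N k : (0 < N)%N ->
  u k = transfer u N k - transfer u N k.+1 + N%:R^-1 * window_sum u N k.
Proof.
move=> N0; have NR : N%:R != 0 :> R by rewrite pnatr_eq0 -lt0n.
apply: (mulfI NR); rewrite /transfer !mulrDr mulrN !mulrA divff// !mul1r.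
apply/eqP; rewrite eq_sym addrAC subr_eq; apply/eqP.
rewrite mulr_natl -[in X in _ *+ X](subn0 N) -sumr_const_nat -!big_split /=.
apply: eq_bigr => m _.
by rewrite -window_sum_recl window_sumS.
Qed.

Section Bounded.
Variable u : nat -> R.
Hypotheses (u0 : forall k, 0 <= u k) (u1 : forall k, u k <= 1).

Lemma window_sum_ge0 n j : 0 <= window_sum u n j.
Proof. by apply: sumr_ge0 => k _. Qed.

Lemma window_sum_le n j : window_sum u n j <= n%:R.
Proof.
elim: n => [|n IH]; first by rewrite window_sum0.
by rewrite window_sumS -natr1 lerD.
Qed.

Lemma transfer_ge0 N k : 0 <= transfer u N k.
Proof.
by rewrite mulr_ge0 ?invr_ge0// sumr_ge0// => m _; exact: window_sum_ge0.
Qed.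

Lemma transfer_le N k : (0 < N)%N -> transfer u N k <= N%:R.
Proof.
move=> N0; rewrite /transfer mulrC ler_pdivrMr ?ltr0n//.
rewrite big_mkord mulr_natr -[in leRHS](card_ord N) -sumr_const.
apply: ler_sum => m _; apply: le_trans (window_sum_le _ _) _.
by rewrite ler_nat card_ord ltnW.
Qed.

Lemma transfer_drop {N mu} k : (0 < N)%N ->
  (forall j, window_sum u N j <= mu * N%:R) ->
  u k <= mu + transfer u N k - transfer u N k.+1.
Proof.
move=> N0 uN; have : N%:R^-1 * window_sum u N k <= mu.
  by rewrite mulrC ler_pdivrMr ?ltr0n.
by have := transfer_coboundary u N k N0; lra.
Qed.

(** Control at one scale [N] gives control at every scale, because the
    differences of the transfer function telescope. *)
Lemma window_sum_growth {N mu} n j : (0 < N)%N ->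
  (forall j, window_sum u N j <= mu * N%:R) ->
  window_sum u n j <= n%:R * mu + N%:R.
Proof.
move=> N0 uN.
suff : window_sum u n j <=
    n%:R * mu + (transfer u N j - transfer u N (n + j)).
  have := transfer_ge0 N (n + j); have := transfer_le N j N0; lra.
elim: n => [|n IH]; first by rewrite window_sum0 subrr; lra.
rewrite window_sumS -natr1.
have := transfer_drop (n + j) N0 uN; rewrite addSn; lra.
Qed.

(** The union bound [1 - prod x_k <= sum (1 - x_k)] for [x_k] in [[0, 1]]. *)
Lemma one_sub_prod_le n j :
  1 - \prod_(0 <= k < n) u (k + j)%N <= n%:R - window_sum u n j.
Proof.
have pr m : 0 <= \prod_(0 <= k < m) u (k + j)%N <= 1.
  rewrite prodr_ge0//=; elim: m => [|m IH]; first by rewrite big_nil.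
  by rewrite big_nat_recr//= mulr_ile1// prodr_ge0.
elim: n => [|n IH]; first by rewrite big_nil window_sum0; lra.
rewrite big_nat_recr//= window_sumS -natr1.
have := pr n; have := u0 (n + j); have := u1 (n + j).
move: IH; set p := \prod_(_ <= _ < _) _; set v := u _; nra.
Qed.

(** [x <= exp (x - 1)] turns linear control of the sums into geometric decay
    of the products. *)
Lemma mean_gap_prod : mean_gap u ->
  exists C lambda : R, [/\ 0 < C, 0 < lambda < 1 & forall n j : nat,
    \prod_(0 <= k < n) u (k + j)%N <= C * lambda ^+ n].
Proof.
move=> [N [mu [N0 mu1 uN]]].
exists (expR N%:R), (expR (mu - 1)); split=> [||n j]; first exact: expR_gt0.
  by rewrite expR_gt0 expR_lt1 subr_lt0.
apply: (@le_trans _ _ (expR (window_sum u n j - n%:R))).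
  elim: n => [|n IH]; first by rewrite big_nil window_sum0 subrr expR0.
  rewrite big_nat_recr//= window_sumS.
  rewrite (_ : _ - _ = (window_sum u n j - n%:R) + (u (n + j)%N - 1)).
    rewrite expRD ler_pM ?prodr_ge0//.
    by have := expR_ge1Dx (u (n + j)%N - 1); lra.
  by rewrite -natr1; ring.
rewrite -expRM_natl -expRD ler_expR mulr_natl.
by have := window_sum_growth n j N0 uN; rewrite -mulr_natl; lra.
Qed.

(** At a length where the products are at most [1 / 2], the union bound makes
    every window sum fall short of the length by at least [1 / 2]. *)
Lemma prod_mean_gap (C lambda : R) : 0 < C -> 0 < lambda < 1 ->
  (forall n j : nat, (0 < n)%N ->
    \prod_(0 <= k < n) u (k + j)%N <= C * lambda ^+ n) ->
  mean_gap u.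
Proof.
move=> C0 /andP[l0 l1] H.
have : (fun n => C * lambda ^+ n) @ \oo --> C * 0.
  by apply: cvgMr; apply: cvg_expr; rewrite ger0_norm// ltW.
have half0 : 0 < 2^-1 :> R by rewrite invr_gt0.
rewrite mulr0 => /cvgr_dist_lt/(_ _ half0)[n _ Hn].
have := Hn n.+1 (leqnSn n); rewrite /= distrC subr0 ger0_norm; last first.
  by rewrite mulr_ge0 ?exprn_ge0// ltW.
move=> Cn; exists n.+1, (1 - 2^-1 / n.+1%:R); split=> [//||j].
  by rewrite gtrBl divr_gt0.
rewrite mulrBl mul1r -mulrA mulVf ?pnatr_eq0// mulr1.
by have := one_sub_prod_le n.+1 j; have := H n.+1 j isT; lra.
Qed.

End Bounded.
End WindowSums.

(** * The uniform mean *)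

Section UniformMean.
Context {R : realType}.
Variable u : nat -> R.
Hypotheses (u0 : forall k, 0 <= u k) (u1 : forall k, u k <= 1).

Let b (n : nat) : R := sup (range (fun j => n%:R^-1 * window_sum u n j)).

Let window_mean_le1 n j : (0 < n)%N -> n%:R^-1 * window_sum u n j <= 1.
Proof.
by move=> n0; rewrite mulrC ler_pdivrMr ?ltr0n// mul1r window_sum_le.
Qed.

Let window_sum_le_sup n j : (0 < n)%N -> window_sum u n j <= b n * n%:R.
Proof.
move=> n0; rewrite -ler_pdivrMr ?ltr0n// mulrC; apply: ub_le_sup.
  by exists 1 => _ [i _ <-]; exact: window_mean_le1.
by exists j.
Qed.

Let sup_le_const n c : (forall j, n%:R^-1 * window_sum u n j <= c) -> b n <= c.
Proof.
move=> H; apply: ge_sup; first by exists (n%:R^-1 * window_sum u n 0%N), 0%N.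
by move=> _ [j _ <-].
Qed.

Let sup_ge0 n : (0 < n)%N -> 0 <= b n.
Proof.
move=> n0; have := window_sum_le_sup n 0 n0; have := window_sum_ge0 u u0 n 0.
have : 0 < n%:R :> R by rewrite ltr0n.
nra.
Qed.

Let has_inf_b : has_inf [set b m | m in [set m | (0 < m)%N]].
Proof.
by split; [exists (b 1), 1%N | exists 0 => _ [m m0 <-]; exact: sup_ge0].
Qed.

(* The form of subadditivity that gives convergence to the infimum. *)
Let sup_quasi_decreasing n m : (0 < n)%N -> (0 < m)%N ->
  b n <= b m + m%:R / n%:R.
Proof.
move=> n0 m0; apply: sup_le_const => j.
rewrite mulrC ler_pdivrMr ?ltr0n// mulrDl -mulrA mulVf ?pnatr_eq0 -?lt0n//.
have := window_sum_growth u u0 u1 n j m0 (fun j => window_sum_le_sup m j m0).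
by rewrite mulr1 mulrC.
Qed.

(** The supremum of the means over [n]-windows exceeds the one over
    [m]-windows by at most [m / n]; letting [n] tend to infinity, then
    optimizing [m], identifies the limit. *)
Lemma uniform_mean_cvg :
  b n @[n --> \oo] --> inf [set b m | m in [set m | (0 < m)%N]].
Proof.
set L := inf _.
apply/cvgrPdist_le => e e0.
have e20 : 0 < e / 2 by rewrite divr_gt0.
have [_ [m /= m0 <-] bm] := inf_adherent e20 has_inf_b.
have : (fun n => m%:R * harmonic n : R) @ \oo --> m%:R * (0 : R).
  by apply: cvgMr; exact: cvg_harmonic.
rewrite mulr0 => /cvgr_dist_le/(_ _ e20)[n0 _ Hn].
exists n0.+1 => // -[//|n'] /= n0n.
have := Hn n' n0n; rewrite /= distrC subr0 ger0_norm ?divr_ge0//.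
set n := n'.+1; have n1 : (0 < n)%N by [].
have : L <= b n by apply: ge_inf; [case: has_inf_b | exists n].
have := sup_quasi_decreasing n m n1 m0; move: bm; rewrite -/L.
by rewrite ler_norml; lra.
Qed.

Lemma uniform_mean_lt1P : uniform_mean u < 1 <-> mean_gap u.
Proof.
have -> : uniform_mean u = limn b by [].
rewrite (cvg_lim _ uniform_mean_cvg)//; split=> [L1|[N [mu [N0 mu1 uN]]]].
  have [_ [m /= m0 <-] bm] := inf_lt (proj1 has_inf_b) L1.
  by exists m, (b m); split=> // j; exact: window_sum_le_sup.
apply: le_lt_trans mu1; apply: (@le_trans _ _ (b N)).
  by apply: ge_inf; [case: has_inf_b | exists N].
by apply: sup_le_const => j; rewrite mulrC ler_pdivrMr ?ltr0n.
Qed.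

End UniformMean.

(** * Off-diagonal quadratic forms *)

Section JacobiForms.
Context {R : realType}.
Implicit Types (u xi : nat -> R).

(** A Schur test: each product [2 u_k x_k x_(k+1)] is split as
    [t_k x_k ^ 2 + s_k x_(k+1) ^ 2], and the coefficients that reach a given
    [x_k ^ 2] add up to at most [2 rho]. *)
Lemma jacobi_form_le u (t s : nat -> R) (rho : R) xi n :
  (forall k, 0 <= t k) -> (forall k, 0 < s k) ->
  (forall k, u k ^+ 2 <= t k * s k) ->
  t 0%N <= 2 * rho -> (forall k, t k.+1 + s k <= 2 * rho) ->
  \sum_(0 <= k < n) u k * xi k * xi k.+1 <=
    rho * \sum_(0 <= k < n.+1) xi k ^+ 2.
Proof.
move=> t0 s0 uts tr0 tr.
have amgm k : 2 * (u k * xi k * xi k.+1) <=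
    t k * xi k ^+ 2 + s k * xi k.+1 ^+ 2.
  rewrite -subr_ge0 -(pmulr_rge0 _ (s0 k)).
  rewrite [leRHS](_ : _ = (t k * s k - u k ^+ 2) * xi k ^+ 2 +
    (u k * xi k - s k * xi k.+1) ^+ 2); last by ring.
  apply: addr_ge0; last exact: sqr_ge0.
  by rewrite mulr_ge0 ?subr_ge0 ?sqr_ge0.
(* The reserve [t n * xi n ^+ 2] pays for the next off-diagonal term. *)
suff : 2 * \sum_(0 <= k < n) u k * xi k * xi k.+1 <=
    2 * rho * \sum_(0 <= k < n.+1) xi k ^+ 2 - t n * xi n ^+ 2.
  have : 0 <= t n * xi n ^+ 2 by rewrite mulr_ge0 ?sqr_ge0.
  lra.
elim: n => [|n IH].
  rewrite big_nil big_nat1 mulr0 subr_ge0.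
  by rewrite ler_wpM2r ?sqr_ge0.
rewrite big_nat_recr//= [in leRHS]big_nat_recr//=.
have := amgm n; have : (t n.+1 + s n) * xi n.+1 ^+ 2 <= 2 * rho * xi n.+1 ^+ 2.
  by rewrite ler_wpM2r ?sqr_ge0.
move: IH; set A := \sum_(_ <= _ < _) _; set B := \sum_(_ <= _ < _) _.
lra.
Qed.

Lemma contractive_form u xi n :
  (forall k, 0 <= u k) -> (forall k, u k <= 1) ->
  \sum_(0 <= k < n) u k * xi k * xi k.+1 <= \sum_(0 <= k < n.+1) xi k ^+ 2.
Proof.
move=> u0 u1; rewrite -[leRHS]mul1r.
apply: (@jacobi_form_le _ (fun=> 1) (fun=> 1)) => // [k||k]; try lra.
by rewrite mulr1 expr_le1.
Qed.

(** The weights of the Schur test are [t_k = 1 + beta g_k - 2 eps] and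
    [s_k = 1 - beta g_(k+1)], with [g] the transfer function.  Where [u k] is
    close to [1], [g] drops by almost [1 - mu] or more, and this drop makes
    [t_k s_k >= 1]; where [g] does not drop, [u k] is far enough from [1].
    In [t_(k+1) + s_k] the two values of [g] cancel, leaving [2 - 2 eps]. *)
Lemma mean_gap_form u :
  (forall k, 0 <= u k) -> (forall k, u k <= 1) -> mean_gap u ->
  exists rho : R, 0 <= rho < 1 /\ forall xi n,
    \sum_(0 <= k < n) u k * xi k * xi k.+1 <=
      rho * \sum_(0 <= k < n.+1) xi k ^+ 2.
Proof.
move=> u0 u1 [N [mu [N0 mu1 uN]]].
have NR : 1 <= N%:R :> R by rewrite ler1n.
have mu0 : 0 <= mu.
  have := le_trans (window_sum_ge0 u u0 N 0) (uN 0%N).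
  by rewrite pmulr_lge0 ?ltr0n.
pose g := transfer u N.
have g0 k : 0 <= g k by exact: transfer_ge0.
have gN k : g k <= N%:R by exact: transfer_le.
have gu k : u k <= mu + g k - g k.+1 by exact: transfer_drop.
(* [beta] is small enough for the second-order term [beta ^+ 2 * N ^+ 2] to use
   half of the first-order gain [beta * (1 - mu)], and [eps] uses the other
   half. *)
pose beta := (1 - mu) / (2 * N%:R ^+ 2).
pose eps := beta * (1 - mu) / 4.
have betaN : beta * N%:R ^+ 2 = (1 - mu) / 2.
  by rewrite /beta; field; rewrite pnatr_eq0 -lt0n.
have beta0 : 0 < beta.
  by rewrite divr_gt0 ?subr_gt0// mulr_gt0 ?exprn_gt0 ?ltr0n.
have bN : beta * N%:R <= 2^-1 by nra.
have b1 : beta <= 2^-1 by nra.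
have eps0 : 0 < eps by rewrite divr_gt0// mulr_gt0 ?subr_gt0.
have epsE : eps = beta * (1 - mu) / 4 by [].
have eps1 : eps <= 8^-1 by rewrite epsE; nra.
clearbody g beta eps.
have bg k : 0 <= beta * g k <= 2^-1.
  rewrite mulr_ge0 ?(ltW beta0)//=.
  by apply: le_trans bN; rewrite ler_wpM2l ?(ltW beta0).
exists (1 - eps); split; first by apply/andP; split; lra.
move=> xi n.
apply: (@jacobi_form_le _ (fun k => 1 + beta * g k - 2 * eps)
  (fun k => 1 - beta * g k.+1)) => [k|k|k||k].
- by have := bg k; lra.
- by have := bg k.+1; lra.
- have bb : (beta * g k) * (beta * g k.+1) <= beta * (1 - mu) / 2.
    rewrite -[leRHS]mulrA -betaN -!mulrA.
    apply: ler_wpM2l; first exact: ltW beta0.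
    rewrite mulrCA expr2; apply: ler_wpM2l; first exact: ltW beta0.
    exact: ler_pM.
  have sq : u k ^+ 2 <= u k by have := u0 k; have := u1 k; nra.
  have bu : beta * u k <= beta * (mu + g k - g k.+1).
    by apply: ler_wpM2l; [exact: ltW beta0 | exact: gu].
  apply: le_trans sq _.
  have := bg k.+1; have := u1 k;
  have : 0 <= eps * (beta * g k.+1).
    by rewrite mulr_ge0 ?(ltW eps0)//; have /andP[] := bg k.+1.
  nra.
- by have := bg 0%N; lra.
- lra.
Qed.

End JacobiForms.

(** * The norm of square-summable sequences *)

Section Ell2Norm.
Context {R : realType}.
Implicit Types (x y : ell2 R) (v : nat -> R[i]) (K : R).

Lemma normc_conj (z : R[i]) : normc z^* = normc z.
Proof. by rewrite /Num.conj; case: z => p q /=; rewrite sqrrN. Qed.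

Lemma series_sqr_nd v : {homo series (fun k => normc (v k) ^+ 2) :
  m n / (m <= n)%N >-> m <= n}.
Proof. by apply: nondecreasing_series => k _ _; exact: sqr_ge0. Qed.

Lemma square_summable_bounded v K :
  (forall n, series (fun k => normc (v k) ^+ 2) n <= K) -> square_summable v.
Proof.
move=> vK; apply: nondecreasing_is_cvgn; first exact: series_sqr_nd.
by exists K => _ [n _ <-].
Qed.

Lemma hnorm_ge0 x : 0 <= hnorm (@ell2_dot R) x.
Proof. exact: sqrtr_ge0. Qed.

Lemma sqr_hnorm x :
  hnorm (@ell2_dot R) x ^+ 2 = limn (series (fun k => normc (x k) ^+ 2)).
Proof.
rewrite hnorm_ell2E sqr_sqrtr//; apply: limr_ge; first exact: ell2P.
by apply: nearW => n; apply: sumr_ge0 => k _; exact: sqr_ge0.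
Qed.

Lemma series_le_hnorm x n :
  series (fun k => normc (x k) ^+ 2) n <= hnorm (@ell2_dot R) x ^+ 2.
Proof.
rewrite sqr_hnorm; apply: nondecreasing_cvgn_le; last exact: ell2P.
exact: series_sqr_nd.
Qed.

Lemma hnorm_le x K : 0 <= K ->
  (forall n, series (fun k => normc (x k) ^+ 2) n <= K ^+ 2) ->
  hnorm (@ell2_dot R) x <= K.
Proof.
move=> K0 xK; rewrite -(@ler_pXn2r _ 2)// ?nnegrE ?hnorm_ge0// sqr_hnorm.
by apply: limr_le; [exact: ell2P | exact: nearW].
Qed.

Lemma normc_le_hnorm x k : normc (x k) <= hnorm (@ell2_dot R) x.
Proof.
rewrite -(@ler_pXn2r _ 2)// ?nnegrE ?hnorm_ge0 ?normc_ge0//.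
apply: le_trans (series_le_hnorm x k.+1); rewrite seriesSr lerDr.
by apply: sumr_ge0 => i _; exact: sqr_ge0.
Qed.

(** The sum of a complex series is defined through its real and imaginary
    parts, so the triangle inequality has to be passed to the limit on the
    square of the modulus. *)
Lemma normc_csum_le v K : csummable v ->
  (forall n, \sum_(0 <= k < n) normc (v k) <= K) -> normc (csum v) <= K.
Proof.
move=> [cr ci] vK; have K0 : 0 <= K by have := vK 0%N; rewrite big_nil.
rewrite -(@ler_pXn2r _ 2)// ?nnegrE ?normc_ge0// sqr_normcE /=.
pose re := series (fun k => complex.Re (v k)).
pose im := series (fun k => complex.Im (v k)).
have cvg2 : (fun n => re n ^+ 2 + im n ^+ 2) @ \oo -->
    limn re ^+ 2 + limn im ^+ 2.
  by apply: cvgD; rewrite expr2; apply: cvgM.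
rewrite -(cvg_lim _ cvg2)//; apply: limr_le; first exact: cvgP cvg2.
apply: nearW => n.
suff [z [-> -> zK]] : exists z : R[i],
    [/\ re n = complex.Re z, im n = complex.Im z & normc z <= K].
  by rewrite -sqr_normcE ler_pXn2r ?nnegrE ?normc_ge0.
exists (\sum_(0 <= k < n) v k); split; last apply: le_trans (vK n).
- by rewrite /re /series /= raddf_sum.
- by rewrite /im /series /= raddf_sum.
elim: n => [|n IH]; first by rewrite !big_nil normc0.
by rewrite !big_nat_recr//=; apply: le_trans (le_normcD _ _) _; rewrite lerD2r.
Qed.

End Ell2Norm.

(** * The numerical radius of a weighted shift *)

Section NumericalRadius.
Context {R : realType}.
Implicit Types (a : linfty R) (x : ell2 R) (xi : nat -> R).

Lemma dot_wshift_le a rho x : 0 <= rho ->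
  (forall xi n, \sum_(0 <= k < n) normc (a k) * xi k * xi k.+1 <=
      rho * \sum_(0 <= k < n.+1) xi k ^+ 2) ->
  normc (ell2_dot (wshift a x) x) <= rho * hnorm (@ell2_dot R) x ^+ 2.
Proof.
move=> rho0 H; apply: normc_csum_le.
  by apply: csummable_dot; exact: ell2P.
move=> n; apply: (@le_trans _ _
  (rho * series (fun k => normc (x k) ^+ 2) n.+1)).
  apply: le_trans (H (fun k => normc (x k)) n).
  case: n => [|n]; first by rewrite !big_nil.
  rewrite big_nat_recl//= mul0r normc0 add0r [leRHS]big_nat_recr//=.
  rewrite ler_wpDr ?mulr_ge0 ?normc_ge0//; apply: ler_sum => k _.
  by rewrite !normcM normc_conj.
by rewrite ler_wpM2l// series_le_hnorm.
Qed.

Lemma wnorm_le a rho : 0 <= rho ->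
  (forall xi n, \sum_(0 <= k < n) normc (a k) * xi k * xi k.+1 <=
      rho * \sum_(0 <= k < n.+1) xi k ^+ 2) ->
  wnorm a <= rho.
Proof.
move=> rho0 H; rewrite /wnorm /numerical_radius.
set A := [set _ | _ in _]; have [->|/set0P A0] := eqVneq A set0.
  by rewrite sup0.
apply: ge_sup => // _ [x /= x1 <-].
by have := dot_wshift_le a rho x rho0 H; rewrite x1 expr1n mulr1.
Qed.

(** [wnorm] is a supremum, which is an upper bound because the contractive
    weights keep the numerical range bounded. *)
Lemma dot_le_wnorm a x : (forall k, normc (a k) <= 1) ->
  hnorm (@ell2_dot R) x = 1 -> normc (ell2_dot (wshift a x) x) <= wnorm a.
Proof.
move=> a1 x1; apply: ub_le_sup; last by exists x.
exists 1 => _ [y /= y1 <-].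
have := dot_wshift_le a 1 y ler01; rewrite y1 expr1n mulr1; apply=> xi n.
by rewrite mul1r; apply: contractive_form => // k; exact: normc_ge0.
Qed.

Definition phase (z : R[i]) : R[i] := if z == 0 then 1 else z / (normc z)%:C%C.

(** Unimodular factors that conjugate the shift with weights [a] to the one
    with weights [|a|]. *)
Definition phases a n : R[i] := \prod_(0 <= k < n) phase (a k).

Lemma normc_phase z : normc (phase z) = 1.
Proof.
rewrite /phase; case: eqVneq => [_|z0]; first exact: normc1.
have nz : normc z != 0 by apply: contra_neq z0; exact: eq0_normc.
rewrite normcM normcV [normc _%:C%C]/= expr0n /= addr0 sqrtr_sqr.
by rewrite ger0_norm ?normc_ge0// divff.
Qed.

Lemma normc_phases a n : normc (phases a n) = 1.
Proof.
elim: n => [|n IH]; first by rewrite /phases big_nil normc1.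
by rewrite /phases big_nat_recr//= normcM normc_phase mulr1.
Qed.

Lemma mul_conj_normc (z : R[i]) : z * z^* = (normc z ^+ 2)%:C%C.
Proof.
rewrite sqr_normcE /Num.conj; case: z => p q /=.
by apply/eqP; rewrite eq_complex /=; apply/andP; split; apply/eqP; ring.
Qed.

Lemma mul_conj_phase (z : R[i]) : z * (phase z)^* = (normc z)%:C%C.
Proof.
rewrite /phase; case: eqVneq => [->|z0]; first by rewrite mul0r normc0.
have nz : normc z != 0 by apply: contra_neq z0; exact: eq0_normc.
rewrite rmorphM mulrA mul_conj_normc -rmorphV ?unitfE//.
rewrite [X in _ * X](_ : _ = (normc z)^-1%:C%C); last first.
  exact: conjc_real.
by rewrite -rmorphM expr2 mulfK.
Qed.

Lemma aligned_phases a k :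
  a k * phases a k * (phases a k.+1)^* = (normc (a k))%:C%C.
Proof.
rewrite /phases big_nat_recr//= rmorphM [X in _ * X = _]mulrC.
rewrite mulrACA mul_conj_phase.
by rewrite mul_conj_normc (normc_phases a k) expr1n mulr1.
Qed.

End NumericalRadius.

(** * Test vectors supported on a window *)

Section TestVectors.
Context {R : realType}.
Implicit Types (a : linfty R).

Lemma series_window (F : nat -> R) j n :
  (forall m, (j + n <= m)%N ->
    series (fun k => if (j <= k < j + n)%N then F k else 0) m =
    \sum_(0 <= k < n) F (k + j)%N).
Proof.
move=> m jnm; rewrite /series /= (big_cat_nat (n := (j + n)%N))//=.
rewrite [X in _ + X]big_nat [X in _ + X]big1 ?addr0
  => [|k /andP[jnk _]]; last first.
  by rewrite (ltnNge k) jnk andbF.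
rewrite (big_cat_nat (n := j)) ?leq_addr//=.
rewrite [X in X + _]big_nat [X in X + _]big1 ?add0r
  => [|k /andP[_ kj]]; last first.
  by rewrite leqNgt kj.
rewrite -{1}[j]add0n big_addn addKn big_nat [RHS]big_nat.
by apply: eq_bigr => k /= kn; rewrite leq_addl addnC ltn_add2l kn.
Qed.

Lemma cvg_series_window (F : nat -> R) j n :
  series (fun k => if (j <= k < j + n)%N then F k else 0) @ \oo -->
  \sum_(0 <= k < n) F (k + j)%N.
Proof.
apply: cvg_near_cst; exists (j + n)%N => // m /= jnm.
exact: series_window.
Qed.

Section Window.
Variables (a : linfty R) (n j : nat).

(* [n.+1] coordinates of equal modulus, so that [n] weights are seen. *)
Let c : R := Num.sqrt n.+1%:R^-1.

Let test_seq (k : nat) : R[i] :=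
  if (j <= k < j + n.+1)%N then phases a k * c%:C%C else 0.

Let sqr_normc_test_seq k : normc (test_seq k) ^+ 2 =
  if (j <= k < j + n.+1)%N then n.+1%:R^-1 else 0.
Proof.
rewrite /test_seq; case: ifP => _; last by rewrite normc0 expr0n.
rewrite normcM normc_phases mul1r sqr_normcE /= expr0n addr0.
by rewrite sqr_sqrtr// invr_ge0.
Qed.

Let test_seq_ell2 : test_seq \in @ell2_pred R.
Proof.
apply/asboolP; rewrite /square_summable.
rewrite (_ : (fun k => _) = fun k =>
  if (j <= k < j + n.+1)%N then n.+1%:R^-1 else 0); last first.
  by apply/funext => k; exact: sqr_normc_test_seq.
exact: cvgP (cvg_series_window (fun=> n.+1%:R^-1) j n.+1).
Qed.

Let test_vector : ell2 R := Ell2 test_seq_ell2.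

Let hnorm_test_vector : hnorm (@ell2_dot R) test_vector = 1.
Proof.
rewrite hnorm_ell2E (_ : (fun k => _) = fun k =>
  if (j <= k < j + n.+1)%N then n.+1%:R^-1 else 0); last first.
  by apply/funext => k; exact: sqr_normc_test_seq.
rewrite (cvg_lim _ (cvg_series_window (fun=> n.+1%:R^-1) j n.+1))//.
rewrite sumr_const_nat subn0.
by rewrite -[_ *+ n.+1]mulr_natl divff ?pnatr_eq0// sqrtr1.
Qed.

Let Re_dot_test_vector :
  complex.Re (ell2_dot (wshift a test_vector) test_vector) =
  n.+1%:R^-1 * window_sum (fun k => normc (a k)) n j.
Proof.
rewrite /ell2_dot /csum /= (_ : (fun k => _) = fun k =>
  if (j.+1 <= k < j.+1 + n)%N then n.+1%:R^-1 * normc (a k.-1) else 0).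
  rewrite (cvg_lim _ (cvg_series_window _ j.+1 n))// /window_sum mulr_sumr.
  by apply: eq_bigr => k _; rewrite addnS.
apply/funext => -[|k] /=; first by rewrite mul0r.
rewrite addSn !ltnS; rewrite /test_seq.
have [jk|kj] := leqP j k; last by rewrite mulr0 mul0r.
have [kn|nk] := ltnP k (j + n)%N; last first.
  by rewrite addnS !ltnS (ltnNge k) nk !andbF [_^*]rmorph0 mulr0.
rewrite addnS !ltnS (ltnW kn) kn (leqW jk) /=.
have -> : (phases a k.+1 * c%:C%C)^* = (phases a k.+1)^* * c%:C%C.
  by rewrite rmorphM; congr (_ * _); exact: conjc_real.
rewrite mulrA mulrACA aligned_phases -!rmorphM /=.
by rewrite -expr2 sqr_sqrtr ?invr_ge0// mulrC.
Qed.

(** The left-hand side is [n.+1] times the value of the numerical form at the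
    test vector. *)
Lemma window_le_wnorm : (forall k, normc (a k) <= 1) ->
  window_sum (fun k => normc (a k)) n j <= wnorm a * n.+1%:R.
Proof.
move=> a1; rewrite -ler_pdivrMr ?ltr0n// mulrC -Re_dot_test_vector.
apply: le_trans (dot_le_wnorm _ _ a1 hnorm_test_vector).
apply: le_trans (ler_norm _) _; set z := ell2_dot _ _.
rewrite -sqrtr_sqr; case: z => p q /=; rewrite ler_wsqrtr// lerDl sqr_ge0.
by [].
Qed.

End Window.

Lemma wnorm_lt1P a : (forall k, normc (a k) <= 1) ->
  wnorm a < 1 <-> mean_gap (fun k => normc (a k)).
Proof.
move=> a1; split=> [w1|gap]; last first.
  have [|//|rho [/andP[rho0 rho1] form]] := mean_gap_form _ _ _ gap.
    by move=> k; exact: normc_ge0.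
  by apply: le_lt_trans rho1; exact: wnorm_le.
(* For [n >= 2 / (1 - w)] the boundary loss in [w * n.+1] fits below
   [n * (1 + w) / 2]. *)
pose n := (Num.bound (2 / (1 - wnorm a))).+1.
exists n, ((1 + wnorm a) / 2); split=> // [|j]; first lra.
apply: le_trans (window_le_wnorm a n j a1) _.
have n2 : 2 <= n%:R * (1 - wnorm a).
  rewrite -ler_pdivrMr ?subr_gt0//; apply: ltW.
  apply: lt_trans (archi_boundP _) _; last by rewrite ltr_nat.
  by rewrite divr_ge0// subr_ge0 ltW.
by rewrite -natr1; nra.
Qed.

End TestVectors.

(** * Convolution with a geometric sequence *)

Section GeometricConvolution.
Context {R : realType}.

Definition geometric_conv (q : R) (v : nat -> R) k : R :=
  \sum_(0 <= j < k.+1) q ^+ (k - j) * v j.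

Lemma geometric_convS q v k :
  geometric_conv q v k.+1 = q * geometric_conv q v k + v k.+1.
Proof.
rewrite /geometric_conv big_nat_recr//= subnn expr0 mul1r; congr (_ + _).
rewrite mulr_sumr big_nat [RHS]big_nat; apply: eq_bigr => j /= jk.
by rewrite mulrA -exprS subSn.
Qed.

(** Young's inequality for the kernel [q ^ k], whose total mass is
    [(1 - q)^-1].  The recursion [z_(k+1) = q z_k + v_(k+1)] and convexity of
    the square reduce it to an induction on partial sums. *)
Lemma geometric_conv_l2 q v n : 0 <= q < 1 ->
  (1 - q) ^+ 2 * \sum_(0 <= k < n) geometric_conv q v k ^+ 2 <=
  \sum_(0 <= k < n) v k ^+ 2.
Proof.
move=> /andP[q0 q1]; case: n => [|n]; first by rewrite !big_nil mulr0.
suff : (1 - q) ^+ 2 * \sum_(0 <= k < n.+1) geometric_conv q v k ^+ 2 +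
    q * (1 - q) * geometric_conv q v n ^+ 2 <= \sum_(0 <= k < n.+1) v k ^+ 2.
  have : 0 <= q * (1 - q) * geometric_conv q v n ^+ 2.
    by rewrite mulr_ge0 ?sqr_ge0// mulr_ge0// subr_ge0 ltW.
  lra.
(* The extra term in the last [z] is what the next step uses. *)
elim: n => [|n IH].
  rewrite !big_nat1 /geometric_conv big_nat1 subnn expr0 mul1r.
  have := sqr_ge0 (v 0%N); set w := v 0%N ^+ 2; nra.
rewrite big_nat_recr//= [in leRHS]big_nat_recr//= geometric_convS.
move: IH; set z := geometric_conv q v n; set w := v n.+1.
set A := \sum_(_ <= _ < _) _; set B := \sum_(_ <= _ < _) _ => IH.
have convex : (1 - q) * (q * z + w) ^+ 2 <= q * (1 - q) * z ^+ 2 + w ^+ 2.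
  rewrite -subr_ge0 [leRHS](_ : _ = q * ((1 - q) * z - w) ^+ 2); last by ring.
  by rewrite mulr_ge0 ?sqr_ge0.
rewrite [leLHS](_ : _ = (1 - q) ^+ 2 * A + (1 - q) * (q * z + w) ^+ 2).
  lra.
by ring.
Qed.

End GeometricConvolution.

(** * The resolvent of a weighted shift *)

Section Resolvent.
Context {R : realType}.
Variables (a : linfty R) (l : R[i]).

(** Solves the lower triangular system [(T - l) x = y] for [l != 0]. *)
Fixpoint resolvent_seq (y : nat -> R[i]) (k : nat) : R[i] :=
  if k is k'.+1 then l^-1 * (a k' * resolvent_seq y k' - y k)
  else l^-1 * - y 0%N.

Lemma normc_resolvent_seq y k :
  normc (resolvent_seq y k) <= (normc l)^-1 *
    \sum_(0 <= j < k.+1) (\prod_(j <= i < k) ((normc l)^-1 * normc (a i))) *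
      normc (y j).
Proof.
have il0 : 0 <= (normc l)^-1 by rewrite invr_ge0 normc_ge0.
elim: k => [|k IH].
  by rewrite big_nat1 big_geq// mul1r /= normcM normcV normcN.
rewrite big_nat_recr//= [in X in _ <= _ * (_ + X)]big_geq// mul1r.
rewrite normcM normcV ler_wpM2l//; apply: le_trans (le_normcD _ _) _.
rewrite normcN lerD2r normcM.
apply: le_trans (ler_wpM2l (normc_ge0 _) IH) _.
rewrite mulrA mulr_sumr [leLHS]big_nat [leRHS]big_nat.
apply: ler_sum => j /= jk; rewrite (big_nat_recr k)//= mulrA.
by rewrite [_ * (_ * normc (a k))]mulrC [normc (a k) * _]mulrC.
Qed.

Variables (C L : R).
Hypotheses (L0 : 0 <= L) (Ll : L < normc l).
Hypothesis prod_le : forall n j,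
  \prod_(0 <= k < n) normc (a (k + j)%N) <= C * L ^+ n.

Let normcl0 : 0 < normc l := le_lt_trans L0 Ll.

Let l0 : l != 0.
Proof. by apply: contraTneq normcl0 => ->; rewrite normc0 ltxx. Qed.

Let q := L / normc l.

Let q01 : 0 <= q < 1.
Proof. by rewrite divr_ge0 ?normc_ge0//= ltr_pdivrMr// mul1r. Qed.

Let C0 : 0 <= C.
Proof.
have := prod_le 0 0; rewrite big_nil expr0 mulr1; exact: le_trans.
Qed.

(* The total mass of the geometric kernel that dominates the resolvent. *)
Let K := C / normc l / (1 - q).

Let K0 : 0 <= K.
Proof.
by rewrite !divr_ge0 ?normc_ge0// subr_ge0; have /andP[_ /ltW] := q01.
Qed.

Let resolvent_l2 y n :
  \sum_(0 <= k < n) normc (resolvent_seq y k) ^+ 2 <=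
  K ^+ 2 * \sum_(0 <= k < n) normc (y k) ^+ 2.
Proof.
pose v k := normc (y k).
have conv k : normc (resolvent_seq y k) <=
    C / normc l * geometric_conv q v k.
  apply: le_trans (normc_resolvent_seq y k) _.
  rewrite [C / _]mulrC -mulrA ler_wpM2l ?invr_ge0 ?normc_ge0// mulr_sumr.
  rewrite [leLHS]big_nat [leRHS]big_nat; apply: ler_sum => j /= jk.
  rewrite mulrA ler_wpM2r ?normc_ge0// -{1}[j]add0n big_addn.
  rewrite big_split/= prodr_const_nat subn0 mulrC /q exprMn mulrA.
  by rewrite ler_wpM2r// exprn_ge0// invr_ge0 normc_ge0.
have q1 : 0 < 1 - q by rewrite subr_gt0; have /andP[] := q01.
apply: (@le_trans _ _ ((C / normc l) ^+ 2 *
    \sum_(0 <= k < n) geometric_conv q v k ^+ 2)).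
  rewrite mulr_sumr; apply: ler_sum => k _; rewrite -exprMn.
  rewrite lerXn2r ?nnegrE ?normc_ge0//.
  exact: le_trans (normc_ge0 _) (conv k).
rewrite /K [(_ / (1 - q)) ^+ 2]exprMn -[leRHS]mulrA ler_wpM2l ?sqr_ge0// exprVn
  [leRHS]mulrC ler_pdivlMr ?exprn_gt0//.
by rewrite mulrC geometric_conv_l2.
Qed.

Let resolvent_seq_ell2 (y : ell2 R) : resolvent_seq y \in @ell2_pred R.
Proof.
apply/asboolP.
apply: (@square_summable_bounded _ _
  (K ^+ 2 * hnorm (@ell2_dot R) y ^+ 2)) => n.
apply: le_trans (resolvent_l2 y n) _.
by rewrite ler_wpM2l ?sqr_ge0// series_le_hnorm.
Qed.

Let resolvent (y : ell2 R) : ell2 R := Ell2 (resolvent_seq_ell2 y).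

Let resolvent_linear : linear resolvent.
Proof.
move=> c x y; apply/val_inj/funext => k.
rewrite -[LHS]/(resolvent_seq (fun i => (c : R[i]) * x i + y i) k).
rewrite -[RHS]/((c : R[i]) * resolvent_seq x k + resolvent_seq y k).
by elim: k => [|k IH] /=; rewrite ?IH; ring.
Qed.

HB.instance Definition _ :=
  GRing.isLinear.Build _ _ _ _ resolvent resolvent_linear.

(** The kernel of the resolvent is at most [C / |l| * (L / |l|) ^ (k - j)], and
    such a convolution is bounded on square-summable sequences. *)
Lemma not_spectrum_wshift : ~ spectrum (@ell2_dot R) (wshift a) l.
Proof.
apply; exists resolvent; split => [|x|x].
- exists K => y; apply: hnorm_le; first by rewrite mulr_ge0 ?hnorm_ge0.
  move=> n; apply: le_trans (resolvent_l2 y n) _.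
  by rewrite [leRHS]exprMn ler_wpM2l ?sqr_ge0// series_le_hnorm.
- apply/val_inj/funext => k.
  pose z k : R[i] := shift_seq a x k - l * x k.
  rewrite -[LHS]/(resolvent_seq z k) -[RHS]/(x k).
  elim: k => [|k IH] /=; rewrite ?IH /z /=.
    by rewrite add0r opprK mulKf.
  by rewrite opprB addrC subrK mulKf.
- apply/val_inj/funext => k.
  rewrite -[LHS]/(shift_seq a (resolvent_seq x) k - l * resolvent_seq x k).
  rewrite -[RHS]/(x k); case: k => [|k] /=.
    by rewrite mulVKf// add0r opprK.
  by rewrite mulVKf// opprB addrC subrK.
Qed.

End Resolvent.

(** * The spectral radius of a weighted shift *)

Section SpectralRadius.
Context {R : realType}.
Implicit Types (a : linfty R) (l : R[i]).

Let basis_seq (j k : nat) : R[i] := (k == j)%:R.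

Let series_basis j n : series (fun k => normc (basis_seq j k) ^+ 2) n <= 1.
Proof.
rewrite /series /= (_ : \sum_(_ <= _ < _) _ = (j < n)%:R); first by case: ltnP.
elim: n => [|n IH]; first by rewrite big_nil.
rewrite big_nat_recr//= IH /basis_seq ltnS.
by case: (ltngtP j n) => _;
  rewrite ?normc0 ?normc1 ?expr1n ?expr0n ?addr0 ?add0r.
Qed.

Let basis_seq_ell2 j : basis_seq j \in @ell2_pred R.
Proof. exact/asboolP/square_summable_bounded/series_basis. Qed.

Let basis_vector j : ell2 R := Ell2 (basis_seq_ell2 j).

(** The resolvent maps the [j]-th basis vector to a vector whose coordinate
    [n + j] has modulus [prod_(k < n) |a (k + j)| / |l| ^ n.+1]; the norm of
    the resolvent bounds all of these at once. *)
Lemma resolvent_prod a l : l != 0 -> ~ spectrum (@ell2_dot R) (wshift a) l ->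
  exists2 C : R, 0 < C & forall n j,
    \prod_(0 <= k < n) normc (a (k + j)%N) <= C * normc l ^+ n.
Proof.
move=> l0 /contrapT[S [[M SM] _ TS]].
have nl0 : 0 < normc l.
  rewrite lt_neqAle normc_ge0 andbT eq_sym.
  by apply: contra_neq l0; exact: eq0_normc.
exists ((`|M| + 1) * normc l) => [|n j].
  by rewrite mulr_gt0// ltr_wpDl.
pose x := S (basis_vector j).
have eqx k : shift_seq a x k - l * x k = basis_seq j k.
  by rewrite -[RHS]/(basis_vector j k) -[in RHS](TS (basis_vector j)).
have x0 k : (k < j)%N -> x k = 0.
  elim: k => [|k IH] kj; apply: (mulfI l0); rewrite mulr0.
    have := eqx 0%N; rewrite /basis_seq /= ltn_eqF// sub0r => /eqP.
    by rewrite oppr_eq0 => /eqP.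
  have := eqx k.+1; rewrite /basis_seq /= ltn_eqF// IH 1?ltnW// mulr0 sub0r.
  by move=> /eqP; rewrite oppr_eq0 => /eqP.
have shift0 k : (k <= j)%N -> shift_seq a x k = 0.
  by case: k => // k kj; rewrite /= x0// mulr0.
have -> : \prod_(0 <= k < n) normc (a (k + j)%N) =
    normc (x (n + j)%N) * normc l ^+ n.+1.
  elim: n => [|n IH].
    rewrite big_nil expr1 mulrC -normcM add0n -normcN.
    have := eqx j; rewrite /basis_seq eqxx.
    by rewrite shift0// sub0r => ->; rewrite normc1.
  have stepx : normc l * normc (x (n.+1 + j)%N) =
      normc (a (n + j)%N) * normc (x (n + j)%N).
    rewrite -!normcM; congr normc; apply/esym/eqP; rewrite -subr_eq0.
    have := eqx (n.+1 + j)%N; rewrite /basis_seq addSn /= => ->.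
    by rewrite gtn_eqF// ltnS leq_addl.
  rewrite big_nat_recr//= IH [in RHS]exprS mulrA [_ * normc l]mulrC stepx.
  by rewrite mulrAC [normc (x _) * _]mulrC.
rewrite exprS mulrA ler_wpM2r ?exprn_ge0 ?normc_ge0// ler_wpM2r ?normc_ge0//.
apply: le_trans (normc_le_hnorm x _) _; apply: le_trans (SM _) _.
apply: le_trans (ler_wpM2r (hnorm_ge0 _) (ler_norm M)) _.
apply: (@le_trans _ _ (`|M| * 1)); last by rewrite mulr1 lerDl.
rewrite ler_wpM2l//; apply: hnorm_le => // m.
by rewrite expr1n; exact: series_basis.
Qed.

Lemma spectral_radius_le a (C L : R) : 0 <= L ->
  (forall n j, \prod_(0 <= k < n) normc (a (k + j)%N) <= C * L ^+ n) ->
  spectral_radius (@ell2_dot R) (wshift a) <= L.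
Proof.
move=> L0 H; rewrite /spectral_radius.
set A := [set _ | _ in _]; have [->|/set0P A0] := eqVneq A set0.
  by rewrite sup0.
apply: ge_sup => // _ [l /= sl <-]; rewrite leNgt; apply/negP => Ll.
exact: (not_spectrum_wshift a l C L).
Qed.

(** Contractive weights put the spectrum in the unit disk, so its supremum is
    a true bound, and any [p] strictly between it and [1] is a point where
    the resolvent exists. *)
Lemma spectral_radius_lt1_prod a : (forall k, normc (a k) <= 1) ->
  spectral_radius (@ell2_dot R) (wshift a) < 1 ->
  exists C lambda : R, [/\ 0 < C, 0 < lambda < 1 & forall n j,
    \prod_(0 <= k < n) normc (a (k + j)%N) <= C * lambda ^+ n].
Proof.
move=> a1; set r := spectral_radius _ _ => r1.
have ub l : spectrum (@ell2_dot R) (wshift a) l -> normc l <= r.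
  move=> sl; apply: ub_le_sup; last by exists l.
  exists 1 => _ [m /= sm <-]; rewrite leNgt; apply/negP => m1.
  apply: (not_spectrum_wshift a m 1 1) sm => // n j.
  rewrite expr1n mulr1; elim: n => [|n IH]; first by rewrite big_nil.
  rewrite big_nat_recr//= mulr_ile1 ?normc_ge0//.
  by apply: prodr_ge0 => k _; exact: normc_ge0.
pose p := (Num.max r 0 + 1) / 2.
have [p0 p1 rp] : [/\ 0 < p, p < 1 & r < p].
  by rewrite /p; split; case: (leP r 0); lra.
have np : normc p%:C%C = p by rewrite /= expr0n addr0 sqrtr_sqr ger0_norm// ltW.
have [|/ub|C C0 H] := @resolvent_prod a p%:C%C.
- by apply: contraTneq p0 => p0; rewrite -np p0 normc0 ltxx.
- by rewrite np leNgt rp.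
by exists C, p; split=> [//||n j]; [rewrite p0 | rewrite -np].
Qed.

End SpectralRadius.

(** * Equivalence of the four conditions *)

Lemma normc_le_linfty_norm (R : realType) (a : linfty R) k :
  normc (a k) <= linfty_norm a.
Proof.
apply: ub_le_sup; last by exists k.
by have [M aM] := linfty_bounded a; exists M => _ [i _ <-].
Qed.

Theorem theorem4p5 (R : realType) (a : linfty R) (ha : linfty_norm a = 1) :
  [<-> spectral_radius (@ell2_dot R) (wshift a) < 1;
       uniform_mean (fun k => normc (a k)) < 1;
       wnorm a < 1;
       exists C lambda : R, [/\ 0 < C, 0 < lambda < 1 &
         forall n j : nat, (0 < n)%N ->
           \prod_(0 <= k < n) normc (a (k + j)%N) <= C * lambda ^+ n] ].
Proof.
have a0 k : 0 <= normc (a k) by exact: normc_ge0.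
have a1 k : normc (a k) <= 1 by rewrite -ha; exact: normc_le_linfty_norm.
tfae.
- move=> /(spectral_radius_lt1_prod _ a1)[C [L [C0 L01 H]]].
  apply/uniform_mean_lt1P => //.
  by apply: (prod_mean_gap _ a0 a1 C L) => // n j _.
- by move=> /(uniform_mean_lt1P _ a0 a1)/(wnorm_lt1P _ a1).
- move=> /(wnorm_lt1P _ a1)/(mean_gap_prod _ a0 a1)[C [L [C0 L01 H]]].
  by exists C, L; split=> // n j _.
- move=> [C' [L' [C'0 L'01 H']]].
  have gap := prod_mean_gap _ a0 a1 C' L' C'0 L'01 H'.
  have [C [L [C0 /andP[L0 L1] H]]] := mean_gap_prod _ a0 a1 gap.
  exact: le_lt_trans (spectral_radius_le a C L (ltW L0) H) L1.
Qed.
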